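(* Let $I$ be a monomial ideal in $R=K[x_1,\ldots,x_n]$, let $<$ be a total order on $G(I)=\{m_1<\cdots<m_\mu\}$, and let $F=\{m_{i_1}<m_{i_2}<\cdots<m_{i_t}\}$ ($t\ge1$) be a subset of $G(I)$. Then the symbol $u=u(i_1;i_2;\ldots;i_t)$ satisfies exactly one of the following four properties: (1) $u$ is an $L$-admissible symbol that is not stable, and $F$ is a preserved cover; (2) $u$ is a stable $L$-admissible symbol, and $F$ is preserved and is not a cover; (3) $u$ is a stable symbol that is $L$-inadmissible, and $F$ is not preserved and is not a cover; (4) $u$ is a non-stable symbol that is $L$-inadmissible, and $F$ is not preserved and $F$ is a cover.
   Context: $K$ is a field and $G(I)$ denotes the minimal set of monomial generators of $I$, written in increasing order for the given (arbitrary) total order $<$ on $G(I)$. For $A\subseteq G(I)$, $\mathrm{lcm}(A)$ is the least common multiple of the elements of $A$ (with $\mathrm{lcm}(\emptyset)=1$) and $\min(A)$ is its least element under $<$. A symbol is $u(i_1;\ldots;i_t)$ with $1\le i_1<\cdots<i_t\le\mu$. It is $L$-admissible if for all $h<t$ and all $q<i_h$, $m_q$ does not divide $\mathrm{lcm}(m_{i_h},\ldots,m_{i_t})$, and $L$-inadmissible otherwise. It is stable if for all $1\le q\le t$, $\mathrm{lcm}(m_{i_1},\ldots,m_{i_t})\ne\mathrm{lcm}(m_{i_1},\ldots,\widehat{m_{i_q}},\ldots,m_{i_t})$. A subset $C\subseteq G(I)$ is a cover if there is $u\in C$ with $u\mid\mathrm{lcm}(C-\{u\})$. A (nonempty) subset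 $D\subseteq G(I)$ is broken if there is $u\in G(I)$ with $u\mid\mathrm{lcm}(D)$ and $u<\min(D)$. A subset $E\subseteq G(I)$ is preserved if no subset of $E$ is broken. *)

(* Defs.v *)
From mathcomp Require Export all_boot all_algebra finmap.
From mathcomp Require Export mpoly.

Set Implicit Arguments.
Unset Strict Implicit.
Unset Printing Implicit Defensive.

Import GRing.Theory.

Local Open Scope fset_scope.
Local Open Scope ring_scope.

(* Monomials of K[x_1, ..., x_n] are represented by their exponent vectors
   m : 'X_{1..n}; the corresponding polynomial is 'X_[m].  Hence (u <= v)%MM is
   divisibility of monomials and 0%MM is the monomial 1. *)

Section MonomialIdeals.

Variables (K : fieldType) (n : nat).

(* The library's idealr_closed only describes proper ideals; here the unit
   ideal is allowed. *)
Definition is_ideal (I : {mpoly K[n]} -> Prop) : Prop :=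
  [/\ I 0,
      forall p q, I p -> I q -> I (p + q)
    & forall a p, I p -> I (a * p)].

Definition monomial_span (S : 'X_{1..n} -> Prop) (p : {mpoly K[n]}) : Prop :=
  forall J : {mpoly K[n]} -> Prop,
    is_ideal J -> (forall m, S m -> J 'X_[m]) -> J p.

Definition generated_by (I : {mpoly K[n]} -> Prop) (S : 'X_{1..n} -> Prop) :
    Prop :=
  forall p, I p <-> monomial_span S p.

Definition monomial_ideal (I : {mpoly K[n]} -> Prop) : Prop :=
  exists S : 'X_{1..n} -> Prop, generated_by I S.

(* G = G(I); it is unique, and finite by Dickson's lemma. *)
Definition minimal_monomial_generators
    (I : {mpoly K[n]} -> Prop) (G : {fset 'X_{1..n}}) : Prop :=
  generated_by I (fun m => m \in G) /\
  forall G' : {fset 'X_{1..n}},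
    G' `<` G -> ~ generated_by I (fun m => m \in G').

End MonomialIdeals.

Definition strict_total_order_on (T : choiceType) (G : {fset T}) (lt : rel T) :
    Prop :=
  [/\ {in G, irreflexive lt},
      {in G & &, transitive lt}
    & {in G &, forall x y, x != y -> lt x y || lt y x}].

Section Subsets.

Variables (n : nat) (G : {fset 'X_{1..n}}) (lt : rel 'X_{1..n}).

Definition lcm_set (A : {fset 'X_{1..n}}) : 'X_{1..n} :=
  \big[@mlcm n/0%MM]_(u <- A) u.

Definition is_min (A : {fset 'X_{1..n}}) (v : 'X_{1..n}) : Prop :=
  v \in A /\ forall w, w \in A -> w != v -> lt v w.

Definition cover (C : {fset 'X_{1..n}}) : Prop :=
  C `<=` G /\ exists2 u, u \in C & (u <= lcm_set (C `\ u))%MM.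

Definition broken (D : {fset 'X_{1..n}}) : Prop :=
  [/\ D `<=` G, D != fset0
    & exists u v, [/\ u \in G, (u <= lcm_set D)%MM, is_min D v & lt u v]].

Definition preserved (E : {fset 'X_{1..n}}) : Prop :=
  E `<=` G /\ forall D : {fset 'X_{1..n}}, D `<=` E -> ~ broken D.

End Subsets.

(* The symbol u(i_1; ...; i_t), with both the positions 1..t and the indices
   1..mu shifted to start at 0. *)
Record symbol (mu t : nat) := Symbol {
  symbol_index :> 'I_t -> 'I_mu;
  symbol_incr : {homo symbol_index : a b / (a < b)%N}
}.

Section Symbols.

Variables (n mu t : nat) (m : 'I_mu -> 'X_{1..n}) (u : symbol mu t).

(* The last position h = t - 1 is excluded: this is the condition h < t of the
   1-based numbering. *)
Definition L_admissible : Prop :=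
  forall h : 'I_t, (h.+1 < t)%N -> forall q : 'I_mu, (q < u h)%N ->
    ~~ (m q <= \big[@mlcm n/0%MM]_(k < t | (h <= k)%N) m (u k))%MM.

Definition stable : Prop :=
  forall q : 'I_t,
    \big[@mlcm n/0%MM]_(k < t) m (u k)
      <> \big[@mlcm n/0%MM]_(k < t | k != q) m (u k).

End Symbols.

Definition exactly_one_of_four (P1 P2 P3 P4 : Prop) : Prop :=
  [\/ [/\ P1, ~ P2, ~ P3 & ~ P4],
      [/\ ~ P1, P2, ~ P3 & ~ P4],
      [/\ ~ P1, ~ P2, P3 & ~ P4]
    | [/\ ~ P1, ~ P2, ~ P3 & P4]].

(* Main.v *)
Require Import Defs.

Set Implicit Arguments.
Unset Strict Implicit.
Unset Printing Implicit Defensive.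

Local Open Scope fset_scope.

(** The four cases are the four combinations of two dichotomies, because a
    symbol is stable exactly when its set of monomials is not a cover
    ([cover_unstable]) and is L-admissible exactly when that set is preserved
    ([L_admissible_preserved]).

    The first equivalence is immediate from the universal property of the lcm:
    deleting a monomial leaves the lcm unchanged iff that monomial divides the
    lcm of the others.

    For the second one, L-admissibility says that none of the tails
    {m_(i_h), ..., m_(i_t)} with h < t is broken.  Tails suffice: if D is broken
    with minimum m_(i_h), then the tail starting at h contains D, has the same
    minimum and an lcm that is a multiple of lcm(D), so it is broken by the same
    monomial.  The last tail, a singleton, escapes the definition of
    L-admissibility, but it is never broken, since minimal monomial generators
    do not divide one another ([minimal_generators_antichain]).

    Both properties of the symbol are decidable, so that exactly one of the four
    combinations occurs, constructively. *)

(** * Least common multiples of families of monomials *)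

Lemma lepm_anti n (v w : 'X_{1..n}) : (v <= w)%MM -> (w <= v)%MM -> v = w.
Proof.
move=> /mnm_lepP vw /mnm_lepP wv; apply/mnmP => i.
by apply/eqP; rewrite eqn_leq vw wv.
Qed.

Lemma bigmlcm_seq_lepP n (J : eqType) (r : seq J) (P : pred J)
    (f : J -> 'X_{1..n}) w :
  reflect (forall j, j \in r -> P j -> (f j <= w)%MM)
          (\big[@mlcm n/0%MM]_(j <- r | P j) f j <= w)%MM.
Proof.
elim: r => [|j r IHr].
  rewrite big_nil; apply: (iffP idP) => // _.
  by apply/mnm_lepP => i; rewrite mnm0E.
have -> : (\big[@mlcm n/0%MM]_(k <- j :: r | P k) f k <= w)%MM =
          (P j ==> (f j <= w)%MM) &&
          (\big[@mlcm n/0%MM]_(k <- r | P k) f k <= w)%MM.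
  by rewrite big_cons; case: (P j); rewrite //= lem_mlcm.
apply: (iffP andP) => [[/implyP le_j /IHr le_r] k | le_w].
  by rewrite inE => /orP[/eqP ->|]; [apply: le_j | apply: le_r].
split; first by apply/implyP; apply: le_w; rewrite mem_head.
by apply/IHr => k kr; apply: le_w; rewrite inE kr orbT.
Qed.

Lemma bigmlcm_lepP n (J : finType) (P : pred J) (f : J -> 'X_{1..n}) w :
  reflect (forall j, P j -> (f j <= w)%MM)
          (\big[@mlcm n/0%MM]_(j | P j) f j <= w)%MM.
Proof.
apply: (iffP (bigmlcm_seq_lepP _ _ _ _)) => le_w j.
  by apply: le_w; apply: mem_index_enum.
by move=> _ /le_w.
Qed.

Lemma lcm_set_lepP n (A : {fset 'X_{1..n}}) w :
  reflect (forall x, x \in A -> (x <= w)%MM) (lcm_set A <= w)%MM.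
Proof.
by apply: (iffP (bigmlcm_seq_lepP _ _ _ _)) => le_w x /le_w //; apply.
Qed.

Lemma lep_bigmlcm n (J : finType) (P : pred J) (f : J -> 'X_{1..n}) j :
  P j -> (f j <= \big[@mlcm n/0%MM]_(k | P k) f k)%MM.
Proof. by apply/bigmlcm_lepP: j; apply: lepm_refl. Qed.

Lemma lep_lcm_set n (A : {fset 'X_{1..n}}) x :
  x \in A -> (x <= lcm_set A)%MM.
Proof. by apply/lcm_set_lepP: x; apply: lepm_refl. Qed.

(** Repetitions in the family are harmless, as lcm is idempotent; hence [f] need
    not be injective. *)
Lemma lcm_set_imfset n (J : finType) (P : pred J) (f : J -> 'X_{1..n})
    (A : {fset 'X_{1..n}}) :
  (forall x, x \in A <-> exists2 j, P j & x = f j) ->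
  lcm_set A = \big[@mlcm n/0%MM]_(j | P j) f j.
Proof.
move=> AE; apply: lepm_anti.
  by apply/lcm_set_lepP => x /AE[j Pj ->]; apply: lep_bigmlcm.
by apply/bigmlcm_lepP => j Pj; apply: lep_lcm_set; apply/AE; exists j.
Qed.

(** * Minimal monomial generators *)

(** If [x] properly divided [y], then [y] would already lie in every ideal
    containing the other generators, so [y] could be removed. *)
Lemma minimal_generators_antichain (K : fieldType) n
    (I : {mpoly K[n]} -> Prop) (G : {fset 'X_{1..n}}) x y :
  minimal_monomial_generators I G ->
  x \in G -> y \in G -> (x <= y)%MM -> x = y.
Proof.
move=> [genG minG] xG yG xy; apply/eqP/negPn/negP => x_neq_y.
apply: (minG _ (fproperD1 yG)) => p.
have spanE : monomial_span (fun m => m \in G `\ y) p <->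
             monomial_span (fun m => m \in G) p.
  split=> span J idJ subJ; apply: span => // z.
    by rewrite !inE => /andP[_ zG]; apply: subJ.
  move=> zG; have [->|z_neq_y] := eqVneq z y; last first.
    by apply: subJ; rewrite !inE z_neq_y.
  have [_ _ mulJ] := idJ.
  rewrite -(submK xy) mpolyXD; apply: mulJ.
  by apply: subJ; rewrite !inE x_neq_y.
by rewrite genG spanE.
Qed.

(** * Stability and covers *)

(** Deleting a monomial from a family changes the lcm iff the monomial does not
    divide the lcm of the others; this also makes stability decidable. *)
Lemma stableE n mu t (m : 'I_mu -> 'X_{1..n}) (u : symbol mu t) :
  stable m u <->
  [forall q, ~~ (m (u q) <= \big[@mlcm n/0%MM]_(k < t | k != q) m (u k))%MM].
Proof.
split=> [st | /forallP st q eq_lcm].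
  apply/forallP => q; apply/negP => dvd_q; apply: (st q); apply: lepm_anti.
    apply/bigmlcm_lepP => k _; have [-> //|k_neq_q] := eqVneq k q.
    exact: (lep_bigmlcm (fun k => m (u k))).
  by apply/bigmlcm_lepP => k _; apply: (lep_bigmlcm (fun k => m (u k))).
move: (st q); rewrite -eq_lcm => /negP; apply.
exact: (lep_bigmlcm (fun k => m (u k))).
Qed.

(** Injectivity matters here: a repeated monomial would make the symbol
    unstable without making its set of monomials a cover. *)
Lemma cover_unstable n mu t (m : 'I_mu -> 'X_{1..n}) (u : symbol mu t)
    (G F : {fset 'X_{1..n}}) :
  injective (fun k => m (u k)) -> F `<=` G -> F = [fset m (u k) | k : 'I_t] ->
  cover G F <-> ~ stable m u.
Proof.
move=> inj_mu subFG hF.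
have lcmD1 q : lcm_set (F `\ m (u q)) =
               \big[@mlcm n/0%MM]_(k < t | k != q) m (u k).
  apply: lcm_set_imfset => x; rewrite !inE hF; split.
    case/andP=> x_neq /imfsetP[k /= _ x_k]; exists k => //.
    by apply: contraNneq x_neq => <-; rewrite x_k.
  case=> k k_neq_q ->; rewrite (inj_eq inj_mu) k_neq_q /=.
  by apply/imfsetP; exists k.
split=> [[_ [v]] | /stableE/negP].
  rewrite {1}hF => /imfsetP[q /= _ ->]; rewrite lcmD1 => dvd_q.
  by move=> /stableE/forallP/(_ q); rewrite dvd_q.
rewrite negb_forall => /existsP[q]; rewrite negbK => dvd_q; split=> //.
by exists (m (u q)); rewrite ?lcmD1 // hF; apply/imfsetP; exists q.
Qed.

(** * L-admissibility and preserved sets *)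

Lemma L_admissibleE n mu t (m : 'I_mu -> 'X_{1..n}) (u : symbol mu t) :
  L_admissible m u <->
  [forall h : 'I_t, (h.+1 < t)%N ==> [forall q : 'I_mu, (q < u h)%N ==>
    ~~ (m q <= \big[@mlcm n/0%MM]_(k < t | (h <= k)%N) m (u k))%MM]].
Proof.
split=> [adm | /forallP adm h ht q qh].
  apply/forallP => h; apply/implyP => ht; apply/forallP => q; apply/implyP.
  exact: adm.
by move/implyP: (adm h) => /(_ ht) /forallP/(_ q)/implyP; apply.
Qed.

Lemma homo_lt_mono n mu (G : {fset 'X_{1..n}}) (lt : rel 'X_{1..n})
    (m : 'I_mu -> 'X_{1..n}) :
  strict_total_order_on G lt -> (forall i, m i \in G) ->
  {homo m : i j / (i < j)%N >-> lt i j} ->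
  {mono m : i j / (i < j)%N >-> lt i j}.
Proof.
move=> [irr tr _] mG incr i j; have [/incr //|lt_ji|eq_ij] := ltngtP i j.
  apply: contraFF (irr _ (mG i)) => lt_ij.
  exact: (tr _ _ _ (mG j) (mG i) (mG i) lt_ij (incr _ _ lt_ji)).
by rewrite (val_inj eq_ij) (irr _ (mG j)).
Qed.

Lemma symbol_mono mu t (u : symbol mu t) : {mono u : a b / (a < b)%N}.
Proof.
move=> a b; have [lt_ab|lt_ba|eq_ab] := ltngtP a b.
- exact: symbol_incr.
- by apply/negbTE; rewrite -leqNgt ltnW // symbol_incr.
- by rewrite (val_inj eq_ab) ltnn.
Qed.

Lemma symbol_inj mu t (u : symbol mu t) : injective u.
Proof.
move=> a b eq_u; apply/val_inj.
by case: (ltngtP a b) => //; rewrite -(symbol_mono u) eq_u ltnn.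
Qed.

(** A broken subset of [F] can be enlarged to a broken tail with the same
    minimum, and L-admissibility says that no tail of at least two monomials is
    broken.  It does not see the last tail, which is a singleton; the antichain
    hypothesis is what keeps that one from being broken. *)
Lemma L_admissible_preserved n mu t (m : 'I_mu -> 'X_{1..n}) (u : symbol mu t)
    (G F : {fset 'X_{1..n}}) (lt : rel 'X_{1..n}) :
  {in G &, forall x y, (x <= y)%MM -> x = y} ->
  injective m -> {mono m : i j / (i < j)%N >-> lt i j} ->
  G = [fset m i | i : 'I_mu] -> F = [fset m (u k) | k : 'I_t] ->
  L_admissible m u <-> preserved G lt F.
Proof.
move=> antiG inj_m mono_m hG hF.
have mG i : m i \in G by rewrite hG; apply/imfsetP; exists i.
have subFG : F `<=` G by apply/fsubsetP => x; rewrite hF => /imfsetP[k _ ->].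
have mono_u := symbol_mono u.
split=> [adm | [_ pres] h ht q lt_qh]; last first.
  (* The tail of F at h is broken by m q. *)
  apply/negP => dvd_q; pose D := [fset m (u k) | k : 'I_t & (h <= k)%N].
  have DE x : x \in D <-> exists2 k : 'I_t, (h <= k)%N & x = m (u k).
    by split=> [/imfsetP[k /= ? ->]|[k ? ->]]; [|apply/imfsetP]; exists k.
  have subDF : D `<=` F.
    by apply/fsubsetP => x /DE[k _ ->]; rewrite hF; apply/imfsetP; exists k.
  have hD : m (u h) \in D by apply/DE; exists h.
  apply: (pres D subDF); split; first exact: fsubset_trans subFG.
    by apply/fset0Pn; exists (m (u h)).
  exists (m q), (m (u h)); split=> //; first by rewrite (lcm_set_imfset DE).
    split=> // w /DE[k le_hk ->] neq.
    rewrite mono_m mono_u ltn_neqAle le_hk andbT.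
    by apply: contraNneq neq => /val_inj ->.
  by rewrite mono_m.
split=> // D /fsubsetP subDF [_ _ [x [y [xG dvd_x [yD miny] lt_xy]]]].
move: xG (subDF _ yD); rewrite {1}hG {1}hF.
move=> /imfsetP[q /= _ x_q] /imfsetP[h /= _ y_h]; subst x y.
rewrite mono_m in lt_xy.
(* As m (u h) is the minimum of D, the tail of F at h contains D. *)
have D_tail w : w \in D -> exists2 k : 'I_t, (h <= k)%N & w = m (u k).
  move=> wD; move: (subDF _ wD); rewrite hF => /imfsetP[k /= _ w_k].
  exists k => //; have [-> //|neq] := eqVneq k h.
  have: lt (m (u h)) w.
    apply: miny wD _; apply: contraNneq neq; rewrite w_k.
    by move=> /inj_m/symbol_inj ->.
  by rewrite w_k mono_m mono_u; apply: ltnW.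
have dvd_tail : (m q <= \big[@mlcm n/0%MM]_(k < t | (h <= k)%N) m (u k))%MM.
  apply: lepm_trans dvd_x _; apply/lcm_set_lepP => w /D_tail[k le_hk ->].
  exact: (lep_bigmlcm (fun k => m (u k))).
have [lt_ht|le_th] := ltnP h.+1 t.
  by have := adm _ lt_ht _ lt_xy; rewrite dvd_tail.
(* At the last position the tail is a single generator. *)
suff /(antiG _ _ (mG q) (mG _))/inj_m eq_q : (m q <= m (u h))%MM.
  by rewrite eq_q ltnn in lt_xy.
apply: lepm_trans dvd_tail _; apply/bigmlcm_lepP => k le_hk.
suff -> : k = h by apply: lepm_refl.
apply/val_inj/eqP; rewrite eqn_leq le_hk andbT -ltnS.
exact: leq_trans (ltn_ord k) le_th.
Qed.

Theorem theorem4p3 (K : fieldType) (n : nat)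
  (I : {mpoly K[n]} -> Prop) (hI : monomial_ideal I)
  (G : {fset 'X_{1..n}}) (hG : minimal_monomial_generators I G)
  (lt : rel 'X_{1..n}) (hlt : strict_total_order_on G lt)
  (mu : nat) (m : 'I_mu -> 'X_{1..n})
  (hm : G = [fset m i | i : 'I_mu])
  (hm_incr : {homo m : i j / (i < j)%N >-> lt i j})
  (t : nat) (ht : (1 <= t)%N) (u : symbol mu t)
  (F : {fset 'X_{1..n}}) (hF : F = [fset m (u k) | k : 'I_t]) :
  exactly_one_of_four
    [/\ L_admissible m u, ~ stable m u, preserved G lt F & cover G F]
    [/\ stable m u, L_admissible m u, preserved G lt F & ~ cover G F]
    [/\ stable m u, ~ L_admissible m u, ~ preserved G lt F & ~ cover G F]
    [/\ ~ stable m u, ~ L_admissible m u, ~ preserved G lt F & cover G F].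
Proof.
have mG i : m i \in G by rewrite hm; apply/imfsetP; exists i.
have mono_m := homo_lt_mono hlt mG hm_incr.
have inj_m : injective m.
  have [irr _ _] := hlt; move=> i j eq_m; apply/val_inj.
  by case: (ltngtP i j) => //; rewrite -mono_m eq_m irr.
have subFG : F `<=` G by apply/fsubsetP => x; rewrite hF => /imfsetP[k _ ->].
have antiG : {in G &, forall x y, (x <= y)%MM -> x = y}.
  by move=> x y; apply: minimal_generators_antichain hG.
have admP := L_admissible_preserved antiG inj_m mono_m hm hF.
have coverP := cover_unstable (inj_comp inj_m (@symbol_inj _ _ u)) subFG hF.
have dec P b : (P <-> is_true b) -> P \/ ~ P.
  by move=> [Pb bP]; case: b Pb bP => Pb bP; [left; apply: bP | right=> /Pb].
have admN := dec _ _ (L_admissibleE m u).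
have stN := dec _ _ (stableE m u).
case: admN => adm; case: stN => st;
  [apply: Or42 | apply: Or41 | apply: Or43 | apply: Or44]; split;
  by [case; tauto | split; tauto].
Qed.
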